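(* Let $G=\mathrm{PSL}(2,3^p)$ for some odd prime $p$, or let $G=\mathrm{PSL}(2,p)$ for some prime $p$ with $p\equiv 19\pmod{24}$ and $p\equiv 2$ or $3\pmod 5$. Then the induced solubility graph $\Delta_S(G)$ does not have a Hamiltonian cycle.
   Context: For a finite group $G$ with soluble radical $R(G)$ (largest soluble normal subgroup), the induced solubility graph $\Delta_S(G)$ is the simple graph with vertex set $G\setminus R(G)$ in which two distinct vertices $x,y$ are adjacent if and only if $\langle x,y\rangle$ is soluble. A Hamiltonian cycle is a cycle visiting each vertex exactly once. *)

(* Defs.v *)
From mathcomp Require Import all_boot all_order all_fingroup all_algebra all_solvable.

Set Implicit Arguments.
Unset Strict Implicit.
Unset Printing Implicit Defensive.

Local Open Scope group_scope.

Section SolubleRadical.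

Variables (gT : finGroupType) (G : {group gT}).

(* The join of all soluble normal subgroups of G; the lemmas below show that
   it is itself soluble and normal, hence the largest such subgroup. *)
Definition soluble_radical : {group gT} :=
  (\prod_(H : {group gT} | (H <| G) && solvable H) H)%G.

Lemma soluble_radical_normal_sol :
  (soluble_radical <| G) && solvable soluble_radical.
Proof.
apply: (big_ind (fun H : {group gT} => (H <| G) && solvable H)) => //.
  by rewrite normal1 solvable1.
move=> H K /andP[nsHG solH] /andP[nsKG solK]; rewrite normalY //=.
have nHK : K \subset 'N(H) := subset_trans (normal_sub nsKG) (normal_norm nsHG).
have nsHHK : H <| H <*> K by rewrite normalYl.
by rewrite (series_sol nsHHK) solH quotientYidl // quotient_sol.
Qed.

Lemma soluble_radical_max (H : {group gT}) :
  H <| G -> solvable H -> H \subset soluble_radical.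
Proof.
move=> nsHG solH; rewrite /soluble_radical bigprodGE.
by apply: subset_trans (subset_gen _); apply: bigcup_sup; rewrite nsHG.
Qed.

End SolubleRadical.

Section SolubilityGraph.

Variables (gT : finGroupType) (G : {group gT}).

Definition solubility_vertices : {set gT} := G :\: soluble_radical G.

Definition solubility_adj : rel gT :=
  [rel x y | [&& x \in solubility_vertices, y \in solubility_vertices,
                 x != y & solvable <<[set x; y]>>]].

End SolubilityGraph.

(* [ucycle] accepts sequences of length 0 and 2, which are not graph cycles,
   hence the lower bound on the size. *)
Definition has_hamiltonian_cycle (T : finType) (V : {set T}) (e : rel T) : Prop :=
  exists c : seq T, [/\ 2 < size c, c =i V & ucycle e c].

Section PSL2.

Variable F : finFieldType.

Definition SL2_set : {set {'GL_2[F]}} :=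
  [set u : {'GL_2[F]} | (\det (GLval u) == 1)%R].

Lemma SL2_group_set : group_set SL2_set.
Proof.
apply/group_setP; split=> [|u v]; first by rewrite inE GL_1E det1.
by rewrite !inE GL_ME det_mulmx => /eqP-> /eqP->; rewrite GRing.mulr1.
Qed.

Definition SL2 : {group {'GL_2[F]}} := Group SL2_group_set.

Definition PSL2 : {group coset_of 'Z(SL2)} := (SL2 / 'Z(SL2))%G.

End PSL2.

(* Main.v *)
Require Import Defs.
From mathcomp Require Import all_boot all_order all_fingroup all_algebra all_solvable.
From mathcomp Require Import all_field ring zify.

Set Implicit Arguments.
Unset Strict Implicit.
Unset Printing Implicit Defensive.

Import GRing.Theory.

(** Write q for the order of F.  Both hypotheses give q = 3 mod 8, q <> 2 mod 3
and q > 3, that is q + 1 = 4k with k odd, prime to 3 and larger than 1.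

The obstruction is that removing the involutions cuts the graph into too many
pieces: a Hamiltonian cycle that loses r vertices falls into at most r arcs
([cycle_label_bound]), but here the number of pieces is at least one more than
the number of involutions.  To tell the pieces apart, label each vertex that is
not an involution by the set of involutions that commute with it.
 - The label is at most a singleton ([invol_unique]).
 - Every involution is the label of some vertex ([invol_centralizer]), and the
   empty set is the label of a unipotent one ([unipotent_no_invol]).
 - The label is constant along the edges ([sol_commute]).
So there is one label for each involution, and one more.

The last point is the heart of the matter.  As -1 is not a square in F, an
involution of PSL(2, q) lifts to a matrix n with n^2 = -1, so that F[n] is a
field of order q^2.  An element that commutes with it and has order > 2 lifts
to u = a + b n with a and b nonzero, a generator of F[n].  Suppose that u and v
generate a soluble group modulo the centre, and let E be a nontrivial abelian
normal subgroup of it, with preimage A in SL(2, q).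
 - If A is abelian, the algebra spanned by A is a quadratic algebra F[m]
   normalized by u, and a computation with traces ([twist_commute]) shows that
   it has to be F[n].  Then v normalizes F[n], hence maps n to n or -n
   ([commute_of_normal_abelian]).
 - If A is not abelian, it contains two anticommuting matrices m and m', and E
   has order at most 4 ([quaternion_card]).  By Frobenius u^(q+1) = 1
   ([gauss_expS_card]), so the image of u^4 has order dividing k and, k being
   prime to 6, centralizes E ([expg_commute_coprime]).  As m and m' generate the
   full matrix algebra, this forces u^16 = 1; together with u^(4k) = 1 and k odd
   it follows that u^4 = 1, so that the image of u has order at most 2.

The unipotent element and those supplied by [invol_centralizer] are indeed
vertices: a member of the soluble radical generates a soluble group with any
other element ([radical_sol]), so that if one of them were in the radical,
[sol_commute] would make the unipotent element commute with an involution. *)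

(** * Two by two matrices *)

Section TwoByTwo.
Local Open Scope ring_scope.
Variable F : fieldType.
Implicit Types (m n w x : 'M[F]_2) (a b c d k A B L R : F).

(** These certify that an equation is a linear combination of given ones: the
premise left at the end is an identity for [ring]. *)
Lemma eq_lin1 k c L R A B : k != 0 -> L = R -> k * (A - B) = c * (L - R) -> A = B.
Proof.
move=> k0 -> E; apply/eqP; rewrite -subr_eq0; move/eqP: E.
by rewrite subrr mulr0 mulf_eq0 (negPf k0).
Qed.

Lemma eq_lin2 k c c' L R L' R' A B : k != 0 -> L = R -> L' = R' ->
  k * (A - B) = c * (L - R) + c' * (L' - R') -> A = B.
Proof.
move=> k0 -> e E; apply: (eq_lin1 k0 e (c := c')).
by rewrite E subrr mulr0 add0r.
Qed.

Lemma eq_lin3 k c c' c'' L R L' R' L'' R'' A B :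
  k != 0 -> L = R -> L' = R' -> L'' = R'' ->
  k * (A - B) = c * (L - R) + c' * (L' - R') + c'' * (L'' - R'') -> A = B.
Proof.
move=> k0 -> e e' E; apply: (eq_lin2 k0 e e' (c := c') (c' := c'')).
by rewrite E subrr mulr0 add0r.
Qed.

Definition mx2 a b c d : 'M[F]_2 :=
  \matrix_(i, j) if i == 0 then if j == 0 then a else b
                 else if j == 0 then c else d.

Lemma mx2_eta m : m = mx2 (m 0 0) (m 0 1) (m 1 0) (m 1 1).
Proof.
apply/matrixP=> i j; rewrite mxE.
by case: i j => [[|[|//]] Hi] [[|[|//]] Hj] /=; congr (m _ _); apply: val_inj.
Qed.

Lemma mx2P (P : 'M[F]_2 -> Prop) :
  (forall a b c d, P (mx2 a b c d)) -> forall m, P m.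
Proof. by move=> Pmx2 m; rewrite (mx2_eta m). Qed.

Lemma mx2_inj a b c d a' b' c' d' :
  mx2 a b c d = mx2 a' b' c' d' -> [/\ a = a', b = b', c = c' & d = d'].
Proof.
move=> E; have e i j := congr1 (fun m : 'M_2 => m i j) E.
by move: (e 0 0) (e 0 1) (e 1 0) (e 1 1); rewrite !mxE.
Qed.

Lemma mx2D a b c d a' b' c' d' :
  mx2 a b c d + mx2 a' b' c' d' = mx2 (a + a') (b + b') (c + c') (d + d').
Proof. by apply/matrixP=> i j; rewrite !mxE; do 2![case: ifP]. Qed.

Lemma mx2N a b c d : - mx2 a b c d = mx2 (- a) (- b) (- c) (- d).
Proof. by apply/matrixP=> i j; rewrite !mxE; do 2![case: ifP]. Qed.

Lemma mx2Z k a b c d : k *: mx2 a b c d = mx2 (k * a) (k * b) (k * c) (k * d).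
Proof. by apply/matrixP=> i j; rewrite !mxE; do 2![case: ifP]. Qed.

Lemma mx2_1 : 1 = mx2 1 0 0 1.
Proof.
by apply/matrixP=> i j; rewrite !mxE; case: i j => [[|[|//]] Hi] [[|[|//]] Hj].
Qed.

Lemma mx2_0 : 0 = mx2 0 0 0 0.
Proof. by apply/matrixP=> i j; rewrite !mxE; do 2![case: ifP]. Qed.

Lemma mx2M a b c d a' b' c' d' :
  mx2 a b c d * mx2 a' b' c' d' =
  mx2 (a * a' + b * c') (a * b' + b * d') (c * a' + d * c') (c * b' + d * d').
Proof.
apply/matrixP=> i j; rewrite -mulmxE !mxE !big_ord_recl big_ord0 addr0 !mxE /=.
by do 2![case: ifP].
Qed.

Lemma mx2_tr a b c d : \tr (mx2 a b c d) = a + d.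
Proof. by rewrite /mxtrace !big_ord_recl big_ord0 addr0 !mxE. Qed.

Lemma mx2_det a b c d : \det (mx2 a b c d) = a * d - b * c.
Proof.
rewrite (expand_det_row _ ord0) !big_ord_recl big_ord0 addr0 !mxE /=.
rewrite /cofactor !det_mx11 !mxE /= /bump /=.
by rewrite expr0 expr1 mul1r !mulN1r mulrN.
Qed.

Definition mx2E := (mx2_tr, mx2_det, mx2_0, mx2_1, mx2D, mx2N, mx2Z, mx2M).

(** The Cayley-Hamilton theorem for a traceless matrix. *)
Lemma sqr_tr0 m : \tr m = 0 -> \det m = 1 -> m * m = -1.
Proof.
elim/mx2P: m => a b c d; rewrite !mx2E => tr0 det1.
congr mx2.
- by apply: (eq_lin2 (oner_neq0 _) tr0 det1 (c := a) (c' := -1)); ring.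
- by apply: (eq_lin1 (oner_neq0 _) tr0 (c := b)); ring.
- by apply: (eq_lin1 (oner_neq0 _) tr0 (c := c)); ring.
- by apply: (eq_lin2 (oner_neq0 _) tr0 det1 (c := d) (c' := -1)); ring.
Qed.

(** A matrix that squares to -1 cannot be triangular, as -1 is not a square; so
it is not scalar, and its minimal polynomial is its characteristic polynomial. *)
Lemma sqr_neg1 m : m * m = -1 -> (forall a : F, a * a != -1) ->
  \tr m = 0 /\ \det m = 1.
Proof.
elim/mx2P: m => a b c d; rewrite !mx2E => /mx2_inj[e1 e2 e3 e4] N.
have [b0|b0] := eqVneq b 0.
  by move: e1; rewrite b0 mul0r addr0 => e1; move: (N a); rewrite e1 eqxx.
have tr0 : a + d = 0.
  by apply: (eq_lin1 b0 e2 (c := 1)); ring.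
split=> //; apply: (eq_lin2 (oner_neq0 _) tr0 e1 (c := a) (c' := -1)); ring.
Qed.

(** Here w is conjugate to its opposite. *)
Lemma anticomm_tr0 m w : 2%:R != 0 :> F -> \det m != 0 ->
  w * m = - (m * w) -> \tr w = 0.
Proof.
move=> n20 dm E.
have um : m \in unitmx by rewrite unitmxE unitfE.
have trN : \tr w = - \tr w.
  rewrite -{1}[w](mulmxK um) -raddfN /=.
  move: E; rewrite -!mulmxE => ->; rewrite mulNmx !raddfN /=.
  by rewrite mxtrace_mulC mulmxA mulVmx // mul1mx.
by apply: (eq_lin1 n20 trN (c := 1)); ring.
Qed.

Definition scalar_matrix m := exists a : F, m = a%:A.

(** The centralizer of a nonscalar matrix m is F[m]: the traceless parts of m and
w are vectors with vanishing cross product, hence proportional. *)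
Lemma commute_nonscalar m w :
  ~ scalar_matrix m -> w * m = m * w -> exists a b, w = a%:A + b *: m.
Proof.
elim/mx2P: m => p q r v; elim/mx2P: w => p' q' r' v' nsm.
rewrite !mx2E => /mx2_inj[e1 e2 e3 e4].
suff [b [hb1 hb2 hb3]]: exists b, [/\ q' = b * q, r' = b * r & p' - v' = b * (p - v)].
  exists (p' - b * p), b; rewrite !mx2E; congr mx2; rewrite ?hb1 ?hb2; try ring.
  by apply: (eq_lin1 (oner_neq0 _) hb3 (c := -1)); ring.
(* The factor b is read off a nonzero coordinate of the traceless part of m. *)
have [q0|q0] := eqVneq q 0; last first.
  exists (q' / q); split; first by field.
  - by apply: (eq_lin1 q0 e1 (c := -1)); field.
  - by apply: (eq_lin1 q0 e2 (c := 1)); field.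
have [r0|r0] := eqVneq r 0; last first.
  exists (r' / r); split; last 1 first.
  - by apply: (eq_lin1 r0 e3 (c := -1)); field.
  - by apply: (eq_lin1 r0 e1 (c := 1)); field.
  - by field.
have pv : p - v != 0.
  rewrite subr_eq0; apply/negP => /eqP pv; apply: nsm; exists p.
  by rewrite !mx2E q0 r0 -pv !mulr0 !mulr1.
exists ((p' - v') / (p - v)); rewrite q0 r0 in e2 e3 *; split; last by rewrite divfK.
- by apply: (eq_lin1 pv e2 (c := -1)); field.
- by apply: (eq_lin1 pv e3 (c := 1)); field.
Qed.

(** Let x = a + b n.  Comparing traces in x m = k m x gives k = 1, in which case m
commutes with x and so with n, or tr (m n) = 0, in which case m anticommutes
with n.  In the latter case the relation becomes m (A - B n) = 0, where
A = a (1 - k) and B = b (1 + k) are not both zero; but then A - B n is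
invertible, as its norm A^2 + B^2 is not zero, -1 not being a square. *)
Lemma twist_commute a b k n m : 2%:R != 0 :> F -> (forall s : F, s * s != -1) ->
    n * n = -1 -> a != 0 -> b != 0 -> \tr m = 0 -> ~ scalar_matrix m ->
    (a%:A + b *: n) * m = k *: (m * (a%:A + b *: n)) ->
  m * n = n * m.
Proof.
move=> n20 N nn a0 b0.
have [] := sqr_neg1 nn N; move: nn.
elim/mx2P: n => s t u s'; elim/mx2P: m => p q r v.
rewrite !mx2E => _ trn detn trm nsm.
have Es' : s' = - s by apply: (eq_lin1 (oner_neq0 _) trn (c := 1)); ring.
have Ev : v = - p by apply: (eq_lin1 (oner_neq0 _) trm (c := 1)); ring.
rewrite {}Es' {}Ev {s' v trn trm} in detn nsm *.
case/mx2_inj=> e1 e2 e3 e4.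
have [k1|k1] := eqVneq k 1.
  rewrite {}k1 in e1 e2 e3 e4.
  congr mx2.
  - by apply: (eq_lin1 b0 e1 (c := -1)); ring.
  - by apply: (eq_lin1 b0 e2 (c := -1)); ring.
  - by apply: (eq_lin1 b0 e3 (c := -1)); ring.
  - by apply: (eq_lin1 b0 e4 (c := -1)); ring.
exfalso.
pose A := a * (1 - k); pose B := b * (1 + k).
have k1' : 1 - k != 0 by rewrite subr_eq0 eq_sym.
have tau : 2%:R * p * s + q * u + r * t = 0.
  by apply: (eq_lin2 (mulf_neq0 b0 k1') e1 e4 (c := 1) (c' := 1)); ring.
(* The entries of m * (A - B n) = 0. *)
have f1 : A * p = B * (p * s + q * u).
  apply: (eq_lin3 n20 e1 e4 tau (c := 1) (c' := -1) (c'' := - B)); rewrite /A /B; ring.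
have f2 : A * q = B * (p * t - q * s).
  apply: (eq_lin1 (oner_neq0 _) e2 (c := 1)); rewrite /A /B; ring.
have f3 : A * r = B * (r * s - p * u).
  apply: (eq_lin1 (oner_neq0 _) e3 (c := 1)); rewrite /A /B; ring.
have f4 : A * - p = B * (r * t + p * s).
  apply: (eq_lin3 n20 e1 e4 tau (c := -1) (c' := 1) (c'' := - B)); rewrite /A /B; ring.
have A0 : A != 0 by rewrite mulf_neq0.
have AB0 : A * A + B * B != 0.
  have [B0|B0] := eqVneq B 0; first by rewrite B0 mul0r addr0 mulf_neq0.
  apply: contra (N (A / B)) => /eqP E; apply/eqP.
  by apply: (eq_lin1 (mulf_neq0 B0 B0) E (c := 1)); field.
(* The entries of m * (A - B n) * (A + B n) = (A^2 + B^2) m. *)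
apply: nsm; exists 0; rewrite !mx2E !mul0r.
have p0 : p = 0.
  apply: (eq_lin3 AB0 f1 f2 detn (c := A + B * s) (c' := B * u) (c'' := - B * B * p)).
  by rewrite /A /B; ring.
have q0 : q = 0.
  apply: (eq_lin3 AB0 f1 f2 detn (c := B * t) (c' := A - B * s) (c'' := - B * B * q)).
  by rewrite /A /B; ring.
have r0 : r = 0.
  apply: (eq_lin3 AB0 f4 f3 detn (c := B * u) (c' := A + B * s) (c'' := - B * B * r)).
  by rewrite /A /B; ring.
by rewrite p0 q0 r0 oppr0.
Qed.

Lemma nonscalar_neg1 m : m * m = -1 -> (forall s : F, s * s != -1) -> ~ scalar_matrix m.
Proof.
move=> mm N [c E]; move: mm; rewrite E !mx2E => /mx2_inj[e _ _ _].
by move: (N c); apply/negP; rewrite negbK -e; apply/eqP; ring.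
Qed.

(** The traceless part of m spans a line that is stable under conjugation by
a + b n, because m and its conjugate have the same trace. *)
Lemma twist_commute_gen a b c k n m : 2%:R != 0 :> F ->
    (forall s : F, s * s != -1) ->
    n * n = -1 -> a != 0 -> b != 0 -> ~ scalar_matrix m ->
    \tr (c%:A + k *: m) = \tr m ->
    (a%:A + b *: n) * m = (c%:A + k *: m) * (a%:A + b *: n) ->
  m * n = n * m.
Proof.
move=> n20 N nn a0 b0 nsm trE E; pose h := \tr m / 2%:R.
have h2 : h * 2%:R = \tr m by rewrite divfK.
have tr1 : \tr (1 : 'M[F]_2) = 2%:R by rewrite mxtrace1.
have ckh : c + k * h = h.
  have {}trE : c * 2%:R + k * (h * 2%:R) = h * 2%:R.
    by rewrite h2 -{2}trE raddfD /= !linearZ /= tr1.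
  by apply: (eq_lin1 n20 trE (c := 1)); ring.
have Em : m = (m - h%:A) + h%:A by rewrite subrK.
have {}nsm : ~ scalar_matrix (m - h%:A).
  by case=> d Ed; apply: nsm; exists (d + h); rewrite Em Ed scalerDl.
have trm0 : \tr (m - h%:A) = 0.
  by rewrite raddfB /= linearZ /= tr1 -/(h * _) h2 subrr.
move: E nsm trm0; rewrite Em addrK; move: (m - _) => m0 E nsm trm0.
suff C : m0 * n = n * m0.
  by rewrite mulrDl mulrDr C -scalerAl -scalerAr mul1r mulr1.
apply: (twist_commute n20 N nn a0 b0 trm0 nsm (k := k)).
move: E; move: (a%:A + b *: n) => x; rewrite mulrDr -scalerAr mulr1 mulrDl.
rewrite scalerDr scalerA mulrDl -!scalerAl !mul1r => E.
by apply: (addIr (h *: x)); rewrite E addrCA -scalerDl ckh.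
Qed.

(** When n^2 = -1, the matrices a + b n multiply like the Gaussian numbers a + b i,
whence the names below. *)
Lemma mul_gauss n a b c d : n * n = -1 ->
  (a%:A + b *: n) * (c%:A + d *: n) = (a * c - b * d)%:A + (a * d + b * c) *: n.
Proof.
move=> nn; rewrite mulrDl !mulrDr -!scalerAl -!scalerAr !mul1r mulr1 nn !scalerA.
by rewrite scalerN scalerBl scalerDl [X in _ + X]addrC addrACA.
Qed.

Lemma gauss_inj n a b c d : ~ scalar_matrix n ->
  a%:A + b *: n = c%:A + d *: n -> a = c /\ b = d.
Proof.
move=> nsn E.
have /eqP: (b - d) *: n = (c - a)%:A.
  by rewrite !scalerBl -[b *: n](addKr a%:A) E -addrA addrC addrK.
have [/eqP|bd] := eqVneq (b - d) 0; last first.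
  move/eqP=> Ebd; case: nsn; exists ((b - d)^-1 * (c - a)).
  by rewrite -scalerA -Ebd scalerA mulVf ?scale1r.
rewrite subr_eq0 => /eqP->; rewrite subrr scale0r eq_sym scaler_eq0 oner_eq0 orbF.
by rewrite subr_eq0 => /eqP.
Qed.

(** The only square roots of -1 in the field F[n] are n and - n. *)
Lemma sqr_neg1_gauss n a b : 2%:R != 0 :> F -> (forall s : F, s * s != -1) ->
    n * n = -1 ->
  (a%:A + b *: n) * (a%:A + b *: n) = -1 -> a = 0 /\ (b = 1 \/ b = -1).
Proof.
move=> n20 N nn; have nsn := nonscalar_neg1 nn N.
rewrite mul_gauss // -[-1]addr0 -(scale0r n) -scaleN1r => /(gauss_inj nsn)[e1 e2].
have a0 : a = 0.
  have [b0|b0] := eqVneq b 0; last first.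
    by apply: (eq_lin1 (mulf_neq0 n20 b0) e2 (c := 1)); ring.
  by move: (N a); apply: contraNeq => _; rewrite -e1 b0 mul0r subr0.
split=> //; have /eqP : (b - 1) * (b + 1) = 0.
  by apply: (eq_lin1 (oner_neq0 _) e1 (c := -1)); rewrite a0; ring.
rewrite mulf_eq0 subr_eq0 addr_eq0 => /orP[] /eqP->; [by left|by right].
Qed.

Lemma det_gauss n a b : n * n = -1 -> (forall s : F, s * s != -1) ->
  \det (a%:A + b *: n) = a * a + b * b.
Proof.
move=> nn N; have [] := sqr_neg1 nn N; elim/mx2P: n {nn} => s t u v.
rewrite !mx2E => tr0 det1.
by apply: (eq_lin2 (oner_neq0 _) tr0 det1 (c := a * b) (c' := b * b)); ring.
Qed.

Lemma tr_gauss n a b : n * n = -1 -> (forall s : F, s * s != -1) ->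
  \tr (a%:A + b *: n) = 2%:R * a.
Proof.
move=> nn N; have [tr0 _] := sqr_neg1 nn N.
by rewrite raddfD /= !linearZ /= tr0 mulr0 addr0 mxtrace1 mulrC.
Qed.

Lemma scalar_det1 m : scalar_matrix m -> \det m = 1 -> m = 1 \/ m = -1.
Proof.
case=> c ->; rewrite !mx2E => dc.
have /eqP : (c - 1) * (c + 1) = 0.
  by apply: (eq_lin1 (oner_neq0 _) dc (c := 1)); ring.
rewrite mulf_eq0 subr_eq0 addr_eq0 => /orP[] /eqP->; [left|right];
  by rewrite ?mx2N ?mx2Z; congr mx2; ring.
Qed.

(** By Cayley-Hamilton, m^2 = 1 and det m = 1 give (tr m) m = 2. *)
Lemma sqr1_det1 m : 2%:R != 0 :> F -> \det m = 1 -> m * m = 1 -> m = 1 \/ m = -1.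
Proof.
move=> n20 dm mm; apply: scalar_det1 => //; move: dm mm.
elim/mx2P: m => a b c d; rewrite !mx2E => dm /mx2_inj[e1 e2 e3 e4].
have tr0 : a + d != 0.
  apply/eqP=> t0; move/eqP: n20; apply.
  by apply: (eq_lin3 (oner_neq0 _) dm e1 t0 (c := -1) (c' := -1) (c'' := a)); ring.
have ad : a = d.
  by apply: (eq_lin2 tr0 e1 e4 (c := 1) (c' := -1)); ring.
have b0 : b = 0 by apply: (eq_lin1 tr0 e2 (c := 1)); ring.
have c0 : c = 0 by apply: (eq_lin1 tr0 e3 (c := 1)); ring.
by exists d; rewrite !mx2E ad b0 c0; congr mx2; ring.
Qed.

Lemma anticomm_sqr m w : 2%:R != 0 :> F -> \det m = 1 -> \det w = 1 ->
  w * m = - (m * w) -> w * w = -1.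
Proof.
move=> n20 dm dw E; apply: sqr_tr0 => //; apply: (anticomm_tr0 n20 _ E).
by rewrite dm oner_neq0.
Qed.

End TwoByTwo.

(** * The field and its quadratic extension *)

Section Field.
Variable F : finFieldType.
Variable k : nat.
Hypothesis card_F : (#|F|.+1 = 4 * k)%N.

(** In characteristic 2 the order of F would be even. *)
Lemma two_neq0 : (2%:R != 0 :> F)%R.
Proof.
apply/negP=> n20; have [p p_pr pF] := finPcharP F.
have c2 : 2 \in [pchar F]%R by rewrite inE.
have := card_pprimeChar c2; move: (logn _ _) => e cF.
have : 1 < #|F| by exact: finNzRing_gt1.
move: card_F; rewrite cF.
by case: e {cF} => [|e]; rewrite ?expn0 ?expnS; lia.
Qed.

(** If s^2 = -1, then s^(q+1) = s^2 = -1 as s^q = s; but s^(4k) = 1. *)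
Lemma neg1_nonsquare (s : F) : (s * s != -1)%R.
Proof.
apply/eqP=> ss; have s2 : (s ^+ 2 = -1)%R by rewrite expr2.
have : (s ^+ #|F|.+1 = s ^+ 2)%R by rewrite exprS expf_card expr2.
rewrite card_F (_ : 4 * k = 2 * (2 * k))%N; last by lia.
rewrite exprM s2 exprM -signr_odd /= expr0 expr1n => E.
by move: two_neq0; rewrite mulr2n {2}E subrr eqxx.
Qed.

Lemma exprDn_pchar_comm (R : nzRingType) p e (x y : R) :
  p \in [pchar R]%R -> GRing.comm x y ->
  ((x + y) ^+ (p ^ e) = x ^+ (p ^ e) + y ^+ (p ^ e))%R.
Proof.
move=> pR cxy; elim: e => [|e IHe]; first by rewrite expn0 !expr1.
rewrite expnSr !exprM IHe -!(pFrobenius_autE pR) pFrobenius_autD_comm //.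
by apply: commrX; apply: commr_sym; apply: commrX; apply: commr_sym.
Qed.

(** Raising to the power q maps n to - n, as q = 3 mod 4, and fixes F; so it maps
a + b n to a - b n. *)
Lemma gauss_expS_card (n : 'M[F]_2) a b : (n * n = -1)%R ->
  ((a%:A + b *: n) ^+ #|F|.+1 = (a * a + b * b)%:A)%R.
Proof.
move=> nn; have [p p_pr pF] := finPcharP F.
have cF := card_pprimeChar pF.
have pM : p \in [pchar 'M[F]_2]%R by rewrite pchar_lalg.
have nq : (n ^+ #|F| = - n)%R.
  have -> : (#|F| = 1 + 2 * (1 + 2 * k.-1))%N by lia.
  rewrite exprD exprM expr2 nn exprD exprM !expr1.
  by rewrite -signr_odd /= expr0 expr1n mulr1 mulrN1.
rewrite exprS cF (exprDn_pchar_comm _ pM); last first.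
  by rewrite /GRing.comm mulr_algl mulr_algr.
rewrite -cF !exprZn expr1n nq !expf_card scalerN -scaleNr mul_gauss //.
by rewrite !mulrN opprK [(b * a)%R]mulrC addNr scale0r addr0.
Qed.
End Field.

(** * Lifting from PSL(2, q) to matrices *)

Section Lift.
Variable F : finFieldType.
Local Notation Z := ('Z(SL2 F))%g.
Local Notation val := (@GLval 2 F).
Implicit Types u v w : {'GL_2[F]}.

Local Notation pr := (coset Z).

Lemma SL2_det u : u \in SL2 F -> (\det (val u) = 1)%R.
Proof. by rewrite inE => /eqP. Qed.

Lemma SL2_lift (m : 'M[F]_2) : (\det m = 1)%R -> exists2 u, u \in SL2 F & val u = m.
Proof.
move=> dm; have um : m \is a GRing.unit by rewrite [_ \is a _]unitmxE dm unitr1.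
by exists (Sub m um); rewrite ?inE SubK ?dm.
Qed.

Lemma val_inj_GL : injective val. Proof. exact: val_inj. Qed.

(** Commuting with the two elementary unipotent matrices is enough to be scalar. *)
Lemma SL2_centerP u :
  reflect (val u = 1 \/ val u = - 1)%R (u \in Z).
Proof.
apply: (iffP (centerP _ _)) => [[uSL uC]|].
  have dU : (\det (mx2 1 1 0 1) = 1 :> F)%R by rewrite mx2_det mulr1 mulr0 subr0.
  have dL : (\det (mx2 1 0 1 1) = 1 :> F)%R by rewrite mx2_det mulr1 mul0r subr0.
  have [[x xSL Ex] [y ySL Ey]] := (SL2_lift dU, SL2_lift dL).
  have {uC} := (congr1 val (uC _ xSL), congr1 val (uC _ ySL)).
  rewrite !GL_ME Ex Ey => -[cx cy]; apply: scalar_det1 (SL2_det uSL).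
  move: cx cy; elim/mx2P: (val u) => a b c d; rewrite !mx2E.
  move=> /mx2_inj[e1 e2 e3 e4] /mx2_inj[f1 f2 f3 f4].
  have n1 := oner_neq0 F.
  have ad : a = d by apply: (eq_lin1 n1 e2 (c := 1%R)); ring.
  have b0 : b = 0%R by apply: (eq_lin1 n1 f1 (c := 1%R)); ring.
  have c0 : c = 0%R by apply: (eq_lin1 n1 e1 (c := (-1)%R)); ring.
  by exists d; rewrite !mx2E ad b0 c0; congr mx2; ring.
case=> E; split.
- by rewrite inE E det1.
- by move=> v _; apply: val_inj_GL; rewrite !GL_ME E mul1r mulr1.
- by rewrite inE E mx2_1 mx2N mx2_det !oppr0 mul0r subr0 mulrNN mulr1.
- by move=> v _; apply: val_inj_GL; rewrite !GL_ME E mulN1r mulrN1.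
Qed.

Lemma valM_eq u v u' v' :
  (u * v = u' * v')%g -> (val u * val v = val u' * val v')%R.
Proof. exact: (congr1 val). Qed.

Lemma valM u v : val (u * v)%g = (val u * val v)%R.
Proof. by []. Qed.

Lemma valMV u : (val u * val u^-1%g = 1)%R.
Proof. by rewrite -valM mulgV. Qed.

Lemma valX u e : val (u ^+ e)%g = (val u ^+ e)%R.
Proof. by elim: e => [|e IHe] //; rewrite expgS exprS valM IHe. Qed.

Lemma SL2_norm u : u \in SL2 F -> u \in 'N(Z)%g.
Proof. exact/subsetP/normal_norm/center_normal. Qed.

Lemma PSL2_lift g : g \in PSL2 F -> exists2 u, u \in SL2 F & g = pr u.
Proof. by case/morphimP=> u _ uS ->; exists u. Qed.

Lemma pr_in u : u \in SL2 F -> pr u \in PSL2 F.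
Proof. exact: mem_quotient. Qed.

Lemma prM u v : u \in SL2 F -> v \in SL2 F -> pr (u * v)%g = (pr u * pr v)%g.
Proof. by move=> uS vS; rewrite morphM ?SL2_norm. Qed.

Lemma prX u e : u \in SL2 F -> pr (u ^+ e)%g = (pr u ^+ e)%g.
Proof. by move=> uS; rewrite morphX ?SL2_norm. Qed.

Lemma pr_eqP u v : u \in SL2 F -> v \in SL2 F ->
  pr u = pr v <-> (val u = val v \/ val u = - val v)%R.
Proof.
move=> uS vS; have [nu nv] := (SL2_norm uS, SL2_norm vS).
split=> [/rcoset_kercosetP-/(_ nu nv)/rcosetP[z /SL2_centerP zZ ->]|E].
  by rewrite GL_ME; case: zZ => ->; rewrite ?mul1r ?mulN1r; [left|right].
apply/rcoset_kercosetP=> //; apply/rcosetP; exists (u * v^-1)%g; last by rewrite mulgKV.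
apply/SL2_centerP; rewrite GL_ME GL_VE.
by case: E => ->; rewrite ?mulNr divrr ?GL_unit //; [left|right].
Qed.

Lemma pr1P u : u \in SL2 F -> pr u = 1%g <-> (val u = 1 \/ val u = - 1)%R.
Proof. by move=> uS; rewrite -(pr_eqP uS (group1 _)) morph1. Qed.

Lemma pr_commP u v : u \in SL2 F -> v \in SL2 F ->
  commute (pr u) (pr v) <->
  (val u * val v = val v * val u \/ val u * val v = - (val v * val u))%R.
Proof.
by move=> uS vS; rewrite /commute -!prM // (pr_eqP (groupM uS vS) (groupM vS uS)).
Qed.

Lemma pr_sqr1P u : (2%:R != 0 :> F)%R -> u \in SL2 F ->
  (pr u * pr u = 1)%g <-> [\/ pr u = 1%g | val u * val u = -1]%R.
Proof.
move=> n20 uS; rewrite -prM // (pr1P (groupM uS uS)) GL_ME; split.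
  case=> E; [left|by right]; apply/pr1P => //; apply: sqr1_det1 => //.
  exact: SL2_det.
case=> [/(pr1P uS)[]->|]; [left|left|by right]; by rewrite ?mulr1 // mulrNN mulr1.
Qed.

Lemma pr_invol u : (2%:R != 0 :> F)%R -> u \in SL2 F ->
  pr u != 1%g -> (pr u * pr u = 1)%g -> (val u * val u = -1)%R.
Proof. by move=> n20 uS /eqP u1 /(pr_sqr1P n20 uS)[]. Qed.

End Lift.

(** * A coprime action on a small group *)

(** The orbits of z on E have at most 4 elements, and a length dividing k,
which is prime to 6. *)
Lemma expg_commute_coprime (gT : finGroupType) (E : {group gT}) (z e : gT) k :
  #|E| <= 4 -> z \in 'N(E)%g -> (z ^+ k = 1)%g -> odd k -> ~~ (3 %| k) ->
  e \in E -> commute z e.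
Proof.
move=> cE nEz zk ok k3 eE.
have dvd_k : #|e ^: <[z]>|%g %| k.
  rewrite -index_cent1; apply: dvdn_trans (dvdn_indexg _ _) _.
  by rewrite -/(order z) order_dvdn zk.
have sE : (e ^: <[z]> \subset E)%g.
  by rewrite class_sub_norm // cycle_subG.
have := leq_trans (subset_leq_card sE) cE.
have e_cl := class_refl <[z]>%g e.
have : 0 < #|e ^: <[z]>|%g by apply/card_gt0P; exists e.
move: dvd_k; set c := #|_| => dvd_k c_gt0 c_le4.
have c1 : c = 1%N.
  have c_odd : odd c by apply: dvdn_odd dvd_k ok.
  have c3 : c != 3 by apply: contraNneq k3 => <-.
  by lia.
have /eqP/cards1P[e' Ee] := c1.
have : (e ^ z)%g \in (e ^: <[z]>)%g by rewrite memJ_class ?cycle_id.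
move: e_cl; rewrite Ee !inE => /eqP-> /eqP ez.
by apply/commute_sym/commgP/conjg_fixP.
Qed.

(** * Involutions and their centralizers *)

Section ProjectiveLinear.
Variables (F : finFieldType) (k : nat).
Hypothesis card_F : (#|F|.+1 = 4 * k)%N.

Local Notation Z := ('Z(SL2 F))%g.
Local Notation val := (@GLval 2 F).
Local Notation pr := (coset Z).
Implicit Types u v w m : {'GL_2[F]}.

Let n20 := two_neq0 card_F.
Let N := neg1_nonsquare card_F.

(** The lifts cannot anticommute, since u would then have trace 0 and square to
-1; so u lies in the centralizer F[w] of w. *)
Lemma gauss_lift u w : u \in SL2 F -> w \in SL2 F -> (val w * val w = -1)%R ->
  (pr u * pr u != 1)%g -> commute (pr u) (pr w) ->
  exists a b, [/\ val u = a%:A + b *: val w, a != 0, b != 0 & a * a + b * b = 1]%R.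
Proof.
move=> uS wS ww u2 cuw.
have nsw := nonscalar_neg1 ww N.
have Cuw : (val u * val w = val w * val u)%R.
  case/(pr_commP uS wS): cuw => // E; case/eqP: u2; apply/(pr_sqr1P n20 uS).
  by right; apply: anticomm_sqr E; rewrite ?SL2_det.
have [a [b Eu]] := commute_nonscalar nsw Cuw.
have ab1 : (a * a + b * b = 1)%R by rewrite -(det_gauss _ _ ww N) -Eu SL2_det.
exists a, b; split=> //; apply: contraNneq u2 => E; apply/eqP/(pr_sqr1P n20 uS).
  right; rewrite Eu E mul_gauss // !(mul0r, mulr0, addr0, sub0r) scale0r addr0.
  by move: ab1; rewrite E mulr0 add0r => ->; rewrite scaleN1r.
left; apply/(pr1P uS); apply: scalar_det1; last exact: SL2_det.
by exists a; rewrite Eu E scale0r addr0.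
Qed.

Lemma invol_commute_eq w w' : w \in SL2 F -> w' \in SL2 F ->
  (val w * val w = -1 -> val w' * val w' = -1 -> val w' * val w = val w * val w' ->
   val w' = val w \/ val w' = - val w)%R.
Proof.
move=> wS w'S ww ww' C.
have [a [b E]] := commute_nonscalar (nonscalar_neg1 ww N) C.
move: ww'; rewrite E => /(sqr_neg1_gauss n20 N ww)[-> []->];
  rewrite scale0r add0r ?scale1r ?scaleN1r; [by left|by right].
Qed.

(** If x lifts to u = a + b w with b nonzero, then F[u] = F[w] is the same field
for both involutions. *)
Lemma invol_unique x i i' : x \in PSL2 F -> i \in PSL2 F -> i' \in PSL2 F ->
  (x * x != 1 -> i != 1 -> i * i = 1 -> i' != 1 -> i' * i' = 1 ->
   commute x i -> commute x i' -> i = i')%g.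
Proof.
case/PSL2_lift=> u uS -> /PSL2_lift[w wS ->] /PSL2_lift[w' wS' ->] u2.
move=> w1 /(pr_invol n20 wS w1) ww w1' /(pr_invol n20 wS' w1') ww' c c'.
have [a [b [Eu a0 b0 _]]] := gauss_lift uS wS ww u2 c.
have [a' [b' [Eu' a0' b0' _]]] := gauss_lift uS wS' ww' u2 c'.
apply/esym/(pr_eqP wS' wS)/invol_commute_eq => //.
have: (val u * val w = val w * val u)%R.
  by rewrite Eu mulrDl mulrDr mulr_algl mulr_algr -scalerAl -scalerAr.
rewrite Eu' mulrDl mulrDr mulr_algl mulr_algr -scalerAl -scalerAr => /addrI.
exact: scalerI.
Qed.

(** If u = a + b w, the trace of u gives a = 1, and then its determinant
a^2 + b^2 = 1 gives b = 0. *)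
Lemma unipotent_no_invol (u : {'GL_2[F]}) : u \in SL2 F -> val u = mx2 1 1 0 1 ->
  (pr u * pr u != 1)%g /\
  forall i, (i \in PSL2 F -> i != 1 -> i * i = 1 -> ~ commute (pr u) i)%g.
Proof.
move=> uS Eu; have u2 : (pr u * pr u != 1)%g.
  apply/eqP=> /(pr_sqr1P n20 uS)[/(pr1P uS)|]; rewrite Eu !mx2E.
    by case=> /mx2_inj[_ + _ _]; rewrite ?oppr0; move/eqP; rewrite oner_eq0.
  case/mx2_inj=> _ + _ _; rewrite oppr0 !mulr1; move/eqP.
  by rewrite -mulr2n (negPf n20).
split=> // i /PSL2_lift[w wS ->] w1 /(pr_invol n20 wS w1) ww c.
have [a [b [E a0 b0 ab1]]] := gauss_lift uS wS ww u2 c.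
have tru : (\tr (val u) = 2%:R)%R by rewrite Eu mx2_tr.
have a1 : (a = 1)%R.
  have := tr_gauss a b ww N; rewrite -E tru -{1}[2%:R%R]mulr1.
  by move/(mulfI n20).
move: ab1; rewrite a1 mulr1 => /eqP; rewrite -subr_eq0 addrC addKr mulf_eq0 (negPf b0) //.
Qed.

Lemma invol_exists : exists i, [/\ i \in PSL2 F, i != 1 & i * i = 1]%g.
Proof.
have dw : (\det (mx2 0 1 (-1) 0) = 1 :> F)%R.
  by rewrite mx2_det mul0r mulrN1 opprK add0r.
have [w wS Ew] := SL2_lift dw.
have ww : (val w * val w = -1)%R.
  by rewrite Ew !mx2E; congr mx2; ring.
exists (pr w); split; first exact: pr_in; last by apply/(pr_sqr1P n20 wS); right.
apply/eqP=> /(pr1P wS) E; apply: (nonscalar_neg1 ww N).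
by case: E => ->; [exists 1%R; rewrite scale1r | exists (-1)%R; rewrite scaleN1r].
Qed.

(** It lifts to a + b w for a point (a, b) of the circle a^2 + b^2 = 1 off both
axes; the hypothesis on k says that q > 3, and then there is one. *)
Lemma invol_centralizer i : 1 < k -> i \in PSL2 F -> (i != 1 -> i * i = 1 ->
  exists2 x, x \in PSL2 F & commute x i /\ x * x != 1)%g.
Proof.
move=> k1 /PSL2_lift[w wS ->] w1 /(pr_invol n20 wS w1) ww.
have nsw := nonscalar_neg1 ww N.
have [t [t0 t1 tN1]] : exists t : F, [/\ t != 0, t - 1 != 0 & t + 1 != 0]%R.
  have /subsetPn[t _ tn] : ~~ ([set: F] \subset [set 0; 1; -1]%R).
    apply/negP=> /subset_leq_card; rewrite cardsT leqNgt -ltnS card_F => /negP; apply.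
    rewrite setUC !cardsU1 cards1.
    by do 2!case: (_ \notin _) => /=; lia.
  exists t; move: tn; rewrite !inE !negb_or => /andP[/andP[t0 t1] tN1].
  by rewrite subr_eq0 addr_eq0.
have d0 : (1 + t * t != 0)%R.
  apply: contra (N t) => /eqP E; apply/eqP.
  by apply: (eq_lin1 (oner_neq0 F) E (c := 1%R)); ring.
(* The rational parametrization of the circle. *)
pose a := ((1 - t * t) / (1 + t * t))%R; pose b := (2%:R * t / (1 + t * t))%R.
have a0 : a != 0%R.
  rewrite mulf_neq0 ?invr_neq0 // (_ : 1 - t * t = - ((t - 1) * (t + 1)))%R; last by ring.
  by rewrite oppr_eq0 mulf_neq0.
have b0 : b != 0%R by rewrite !mulf_neq0 ?invr_neq0.
have [u uS Eu] : exists2 u, u \in SL2 F & (val u = a%:A + b *: val w)%R.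
  by apply: SL2_lift; rewrite (det_gauss _ _ ww N) /a /b; field.
exists (pr u); first exact: pr_in.
split.
  apply/(pr_commP uS wS); left.
  by rewrite Eu mulrDl mulrDr mulr_algl mulr_algr -scalerAl -scalerAr.
apply/eqP=> /(pr_sqr1P n20 uS)[/(pr1P uS)|].
  rewrite Eu => E; move/eqP: b0; apply.
  case: E => E; [have := @gauss_inj _ _ a b 1 0 nsw
                |have := @gauss_inj _ _ a b (-1) 0 nsw];
   by rewrite scale0r addr0 ?scale1r ?scaleN1r => /(_ E)[].
by rewrite Eu => /(sqr_neg1_gauss n20 N ww)[/eqP]; rewrite (negPf a0).
Qed.

(** * Soluble two-generated subgroups *)

Lemma pr_nonscalar u : u \in SL2 F -> (pr u != 1)%g -> ~ scalar_matrix (val u).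
Proof.
move=> uS /eqP u1 sc; apply/u1/(pr1P uS)/scalar_det1 => //; exact: SL2_det.
Qed.

(** Both u and v normalize the centralizer F[m] of m in the matrix algebra, since
their conjugates of m commute with m.  For u this forces F[m] = F[w] by
[twist_commute_gen]; so v normalizes F[w], and the conjugate of w by v is a
square root of -1 in F[w]. *)
Lemma commute_of_normal_abelian (A : {group {'GL_2[F]}}) u v w m :
    A \subset SL2 F -> abelian A -> m \in A -> (pr m != 1)%g ->
    u \in SL2 F -> v \in SL2 F -> w \in SL2 F ->
    u \in 'N(A)%g -> v \in 'N(A)%g ->
    (val w * val w = -1)%R -> (pr u * pr u != 1)%g -> commute (pr u) (pr w) ->
  commute (pr v) (pr w).
Proof.
move=> sA abA mA m1 uS vS wS nAu nAv ww u2 cuw.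
have mS := subsetP sA m mA.
have nsm := pr_nonscalar mS m1.
have nsw := nonscalar_neg1 ww N.
have conjm g : g \in 'N(A)%g ->
    exists c d, val (g * m * g^-1)%g = (c%:A + d *: val m)%R.
  move=> nAg; apply: commute_nonscalar nsm _.
  have C : commute (g * m * g^-1) m.
    apply: (centsP abA) => //.
    by rewrite -mulgA -[g in (g * _)%g]invgK -conjgE memJ_norm ?groupV.
  exact: (congr1 val C).
have [a [b [Eu a0 b0 _]]] := gauss_lift uS wS ww u2 cuw.
have Cmw : (val m * val w = val w * val m)%R.
  have [c [d Em]] := conjm u nAu.
  apply: (twist_commute_gen n20 N ww a0 b0 nsm (c := c) (k := d)).
    rewrite -Em !GL_ME GL_VE -!mulmxE mxtrace_mulC mulmxA -GL_VE.
    by rewrite !mulmxE -GL_ME mulVg mul1r.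
  by rewrite -Eu -Em; apply: valM_eq; rewrite mulgKV.
have [c [d Em]] := commute_nonscalar nsw Cmw.
have d0 : d != 0%R.
  by apply/eqP=> d0; apply: nsm; exists c; rewrite Em d0 scale0r addr0.
have Cv : (val (v * w * v^-1)%g * val w = val w * val (v * w * v^-1)%g)%R.
  have [c' [d' Em']] := conjm v nAv.
  have : (val (v * m * v^-1)%g = c%:A + d *: val (v * w * v^-1)%g)%R.
    rewrite !GL_ME Em mulrDr mulrDl mulr_algr -!scalerAl -scalerAr.
    by rewrite valMV -scalerAl.
  have Cm' : (val (v * m * v^-1)%g * val w = val w * val (v * m * v^-1)%g)%R.
    by rewrite Em' mulrDl mulrDr mulr_algl mulr_algr -scalerAl -scalerAr Cmw.
  move=> E; move: Cm'; rewrite E mulrDl mulrDr mulr_algl mulr_algr.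
  rewrite -scalerAl -scalerAr => /addrI; exact: scalerI.
have vwS : (v * w * v^-1)%g \in SL2 F by rewrite !groupM ?groupV.
have vw2 : (val (v * w * v^-1)%g * val (v * w * v^-1)%g = -1)%R.
  rewrite -GL_ME (_ : _ * _ = v * (w * w) * v^-1)%g; last by rewrite !mulgA mulgKV.
  by rewrite !GL_ME ww mulrN1 mulNr valMV.
have Ev : (val v * val w = val (v * w * v^-1)%g * val v)%R.
  by apply: valM_eq; rewrite mulgKV.
apply/(pr_commP vS wS); rewrite Ev.
case: (invol_commute_eq wS vwS ww vw2 Cv) => ->; rewrite ?mulNr; [by left|by right].
Qed.

(** Anticommuting m and m' generate the matrix algebra. *)
Lemma commute_both_pr1 m m' u : m \in SL2 F -> m' \in SL2 F -> u \in SL2 F ->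
    (val m' * val m = - (val m * val m'))%R ->
    (val u * val m = val m * val u)%R -> (val u * val m' = val m' * val u)%R ->
  pr u = 1%g.
Proof.
move=> mS m'S uS anti c c'.
have anti' : (val m * val m' = - (val m' * val m))%R by rewrite anti opprK.
have mm := anticomm_sqr n20 (SL2_det m'S) (SL2_det mS) anti'.
have [a [b E]] := commute_nonscalar (nonscalar_neg1 mm N) c.
have b0 : b = 0%R.
  move: c'; rewrite E mulrDl mulrDr mulr_algl mulr_algr -scalerAl -scalerAr.
  move=> /addrI/eqP; rewrite anti scalerN -addr_eq0 -scalerDl -valM.
  rewrite scaler_eq0 -mulr2n -mulr_natl mulf_eq0 (negPf n20) /= => /orP[/eqP//|/eqP E0].
  have := congr1 determinant E0; rewrite (SL2_det (groupM mS m'S)) det0.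
  by move/eqP; rewrite oner_eq0.
by apply/(pr1P uS)/scalar_det1; [exists a; rewrite E b0 scale0r addr0 | exact: SL2_det].
Qed.

(** Each u that commutes up to sign with m and m' commutes with both after
multiplication by 1, m, m' or m m', according to the signs. *)
Lemma quaternion_card (E : {set coset_of Z}) m m' :
    m \in SL2 F -> m' \in SL2 F ->
    (val m' * val m = - (val m * val m'))%R ->
    (forall e, e \in E -> [/\ e \in PSL2 F, commute e (pr m) & commute e (pr m')]) ->
  #|E| <= 4.
Proof.
move=> mS m'S anti cE.
pose V4 := [set 1; (pr m)^-1; (pr m')^-1; (pr (m * m'))^-1]%g.
have anti' : (val m * val m' = - (val m' * val m))%R by rewrite anti opprK.
have mm'S : (m * m')%g \in SL2 F by rewrite groupM.
have {}cE : E \subset V4.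
  apply/subsetP=> e /cE[/PSL2_lift[u uS ->]].
  move=> /(pr_commP uS mS) c /(pr_commP uS m'S) c'.
  have kill g : g \in SL2 F -> (val (u * g)%g * val m = val m * val (u * g)%g)%R ->
     (val (u * g)%g * val m' = val m' * val (u * g)%g)%R -> pr u = (pr g)^-1%g.
    move=> gS d d'; apply/eqP; rewrite eq_mulgV1 invgK.
    by rewrite -prM // (commute_both_pr1 mS m'S _ anti d d') ?groupM.
  have [k1 km km' kmm] := And4 (kill 1%g) (kill m) (kill m') (kill (m * m')%g).
  rewrite !inE -!orbA; case: c => c; case: c' => c'.
  - by rewrite k1 ?group1 ?valM ?mulr1 // morph1 invg1 eqxx.
  - rewrite km ?eqxx ?orbT // !valM.
      by rewrite mulrA -c.
    by rewrite -mulrA anti' mulrN !mulrA c' mulNr opprK.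
  - rewrite km' ?eqxx ?orbT // !valM.
      by rewrite -mulrA anti mulrN !mulrA c mulNr opprK.
    by rewrite mulrA -c'.
  - rewrite kmm ?eqxx ?orbT // !valM.
      rewrite !mulrA c !mulNr -!mulrA anti.
      by rewrite !mulrN opprK.
    have -> : (val m' * (val u * (val m * val m')) =
               - (val u * val m' * val m * val m'))%R.
      by rewrite c' !mulNr opprK !mulrA.
    by rewrite -[(_ * val m' * val m)%R]mulrA anti mulrN mulNr opprK !mulrA.
apply: leq_trans (subset_leq_card cE) _.
by rewrite /V4 setUC cardsU1 setUC cardsU1 setUC cardsU1 cards1; do 3!case: (_ \notin _).
Qed.

Lemma order_lift u w : u \in SL2 F -> w \in SL2 F -> (val w * val w = -1)%R ->
  (pr u * pr u != 1)%g -> commute (pr u) (pr w) -> (u ^+ (4 * k) = 1)%g.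
Proof.
move=> uS wS ww u2 cuw; have [a [b [Eu _ _ ab1]]] := gauss_lift uS wS ww u2 cuw.
apply: val_inj_GL; rewrite valX -card_F Eu.
by rewrite (gauss_expS_card card_F _ _ ww) ab1 scale1r.
Qed.

Hypotheses (odd_k : odd k) (k_n3 : ~~ (3 %| k)).

(** Solubility provides a nontrivial abelian normal subgroup E, and the argument
depends on whether its preimage A in SL(2, q) is abelian. *)
Lemma sol_commute x y i : x \in PSL2 F -> y \in PSL2 F -> i \in PSL2 F ->
    (i != 1 -> i * i = 1 -> x * x != 1 -> commute x i ->
    solvable <<[set x; y]>> -> commute y i)%g.
Proof.
case/PSL2_lift=> u uS Ex /PSL2_lift[v vS Ey] /PSL2_lift[w wS Ei] i1.
rewrite Ei in i1 *; move=> /(pr_invol n20 wS i1) ww x2 cxi.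
pose H := <<[set x; y]>>%G => solH.
have [xH yH] : x \in H /\ y \in H by rewrite !mem_gen // !inE eqxx ?orbT.
have H1 : H :!=: 1%g.
  apply: contraNneq x2 => H1; move: xH; rewrite H1 => /set1gP->.
  by rewrite mulg1.
have [E [sEH /andP[_ nEH] E1 /is_abelemP[r r_pr /abelem_abelian abE]]] :=
  solvable_norm_abelem solH (normal_refl H) H1.
have sHG : H \subset PSL2 F.
  by rewrite gen_subG subUset !sub1set Ex Ey !pr_in.
have sEG : E \subset PSL2 F := subset_trans sEH sHG.
pose A := (SL2 F :&: coset Z @*^-1 E)%G.
have AP g : reflect (g \in SL2 F /\ pr g \in E) (g \in A).
  apply: (iffP setIP) => [[gS /morphpreP[]]|[gS gE]]; first by [].
  by split=> //; apply/morphpreP; rewrite SL2_norm.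
have nAP g : g \in SL2 F -> pr g \in H -> g \in 'N(A)%g.
  move=> gS gH; rewrite inE; apply/subsetP=> _ /imsetP[h /AP[hS hE] ->].
  apply/AP; rewrite groupJ // morphJ ?SL2_norm //; split=> //.
  by rewrite memJ_norm // (subsetP nEH).
have sA : A \subset SL2 F by apply: subsetIl.
rewrite Ex in x2 cxi xH; rewrite Ey in yH *.
have [abA|] := boolP (abelian A).
  have [e eE e1] := trivgPn _ E1.
  have [m mS Em] := PSL2_lift (subsetP sEG e eE).
  rewrite Em in eE e1.
  apply: (@commute_of_normal_abelian A u v w m) => //; try exact: nAP.
  exact/AP.
case/subsetPn=> m mA; rewrite -sub_cent1 => /subsetPn[m' m'A /cent1P ncomm].
have [/AP[mS mE] /AP[m'S m'E]] := (mA, m'A).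
have anti : (val m' * val m = - (val m * val m'))%R.
  have /(pr_commP m'S mS)[C|//] := centsP abE _ m'E _ mE.
  by case: ncomm; apply: val_inj_GL; rewrite !valM C.
have cE4 : #|E| <= 4.
  apply: (quaternion_card mS m'S anti) => e eE.
  by split; [apply: (subsetP sEG) | apply: (centsP abE) ..].
have u4k := order_lift uS wS ww x2 cxi.
have u4S : (u ^+ 4)%g \in SL2 F by apply: groupX.
have z_comm e : e \in E -> commute (pr (u ^+ 4)%g) e.
  apply: (expg_commute_coprime cE4 _ _ odd_k k_n3).
    by rewrite prX // groupX // (subsetP nEH).
  by rewrite -prX // -expgM u4k morph1.
have u16 : (u ^+ 16 = 1)%g.
  have sq8 : (val (u ^+ 4)%g * val (u ^+ 4)%g = -1)%R -> (u ^+ 16 = 1)%g.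
    move=> E8; apply: val_inj_GL.
    rewrite (_ : 16 = 4 + 4 + (4 + 4)) // !expgD 2!valM E8.
    by rewrite mulrNN mulr1.
  have anti4 g : g \in SL2 F -> (val (u ^+ 4)%g * val g = - (val g * val (u ^+ 4)%g))%R ->
      (u ^+ 16 = 1)%g.
    by move=> gS /(anticomm_sqr n20 (SL2_det gS) (SL2_det u4S)); apply: sq8.
  have /(pr_commP u4S mS)[c|/(anti4 m mS)//] := z_comm _ mE.
  have /(pr_commP u4S m'S)[c'|/(anti4 m' m'S)//] := z_comm _ m'E.
  have /(pr1P u4S) E4 := commute_both_pr1 mS m'S u4S anti c c'.
  apply: val_inj_GL; rewrite (_ : 16 = 4 + 4 + (4 + 4)) // !expgD 2!valM.
  by case: E4 => ->; rewrite ?mulrNN !mulr1.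
(* The order of u divides gcd (16, 4 k) = 4. *)
have u4 : (u ^+ 4 = 1)%g.
  apply/eqP; rewrite -order_dvdn.
  have : #[u]%g %| gcdn 16 (4 * k) by rewrite dvdn_gcd !order_dvdn u16 u4k !eqxx.
  rewrite (_ : 16 = 4 * 4) // -muln_gcdr (_ : gcdn 4 k = 1) ?muln1 //.
  by apply/eqP; rewrite -/(coprime 4 k) (_ : 4 = 2 ^ 2) // coprime_pexpl // coprime2n.
case/eqP: x2; rewrite -prM //; apply/pr1P; first exact: groupM.
apply: sqr1_det1 => //; first by rewrite SL2_det ?groupM.
have <- : val (u ^+ 4)%g = 1%R by rewrite u4.
by rewrite -valM !expgS expg0 mulg1 !mulgA.
Qed.

End ProjectiveLinear.

(** * Cutting a Hamiltonian cycle *)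

(** The label changes somewhere along the cycle, and only at members of I; so on
leaving the vertices of a given label for the last time the cycle enters I.
Vertices with different labels are followed by different members of I. *)
Lemma cycle_label_bound (T L : finType) (e : rel T) (c : seq T) (I : {set T})
    (l : T -> L) (A : {set L}) :
    ucycle e c ->
    {in [predC I] &, forall x y, e x y -> l x = l y} ->
    {in A, forall a, exists x, [/\ x \in c, x \notin I & l x = a]} ->
    1 < #|A| ->
  #|A| <= #|I|.
Proof.
case/andP=> cyc Uc le lA A1.
pose S := [set x in c | (x \notin I) && (next c x \in I)].
have sAS : A \subset l @: S.
  apply/subsetP=> a aA; apply/negPn/negP=> naS.
  have [x [xc xI lx]] := lA a aA.
  have [b bA ba] : exists2 b, b \in A & b != a.
    have : 0 < #|A :\ a| by rewrite (cardsD1 a A) aA in A1.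
    by case/card_gt0P=> b; rewrite !inE => /andP[ba bA]; exists b.
  have all_a n : let y := iter n (next c) x in [/\ y \in c, y \notin I & l y = a].
    elim: n => [|n]; first by split.
    rewrite iterS; move: (iter n _ x) => y /= [yc yI ly].
    have nI : next c y \notin I.
      apply: contra naS => nI; apply/imsetP; exists y => //.
      by rewrite inE yc yI.
    split=> //; first by rewrite mem_next.
    by rewrite -ly; apply/esym/le => //; apply: next_cycle.
  have [y [yc _ ly]] := lA b bA.
  move: ba; rewrite -ly; have := yc.
  rewrite -(fconnect_cycle (cycle_next Uc) xc) => /iter_findex <-.
  by have [_ _ ->] := all_a (findex (next c) x y); rewrite eqxx.
apply: leq_trans (subset_leq_card sAS) _.
apply: leq_trans (leq_imset_card _ _) _.
rewrite -(card_imset _ (can_inj (prev_next Uc))).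
apply/subset_leq_card/subsetP=> _ /imsetP[x + ->].
by rewrite inE => /and3P[].
Qed.

(** The group lies in the extension of the radical by the cyclic group of g. *)
Lemma radical_sol (gT : finGroupType) (G : {group gT}) x g :
  x \in soluble_radical G -> g \in G -> solvable <<[set x; g]>>.
Proof.
move=> xR gG; have /andP[nRG solR] := soluble_radical_normal_sol G.
have nRg : <[g]>%g \subset 'N(soluble_radical G)%g.
  by rewrite cycle_subG (subsetP (normal_norm nRG)).
suff solRg : solvable (soluble_radical G <*> <[g]>)%G.
  apply: solvableS solRg; rewrite gen_subG subUset !sub1set.
  by rewrite mem_gen ?inE ?xR // mem_gen // inE cycle_id orbT.
have nsR : (soluble_radical G <| soluble_radical G <*> <[g]>)%g by rewrite normalYl.
rewrite (series_sol nsR) solR quotientYidl // quotient_sol //.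
exact/abelian_sol/cycle_abelian.
Qed.

(** * The solubility graph *)

Section Graph.
Variables (F : finFieldType) (k : nat).
Hypothesis card_F : #|F|.+1 = 4 * k.
Hypotheses (odd_k : odd k) (k_n3 : ~~ (3 %| k)) (k_gt1 : 1 < k).

Lemma not_hamiltonian_PSL2 :
  ~ has_hamiltonian_cycle (solubility_vertices (PSL2 F)) (solubility_adj (PSL2 F)).
Proof.
case=> c [_ cV cyc].
pose G := PSL2 F.
pose I := [set i in G | (i != 1)%g && (i * i == 1)%g].
pose l x := (I :&: 'C[x])%g.
have IP i : i \in I -> [/\ i \in G, i != 1 & i * i = 1]%g.
  by rewrite inE => /and3P[iG i1 /eqP].
have notI x : x \in solubility_vertices G -> x \notin I -> x \in G /\ (x * x != 1)%g.
  case/setDP=> xG xR; rewrite inE xG /= negb_and negbK => /orP[/eqP x1|//].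
  by case/negP: xR; rewrite x1.
have sol_sub x y : x \in G -> y \in G -> (x * x != 1)%g -> solvable <<[set x; y]>> ->
    l x \subset l y.
  move=> xG yG x2 sol; apply/subsetP=> i /setIP[iI /cent1P cxi].
  have [iG i1 i2] := IP i iI; rewrite inE iI; apply/cent1P.
  apply: commute_sym.
  exact: (sol_commute card_F odd_k k_n3 xG yG iG i1 i2 x2 (commute_sym cxi) sol).
have [u [uG u2 uI]] : exists u, [/\ u \in G, u * u != 1 & l u = set0]%g.
  have dU : (\det (mx2 1 1 0 1) = 1 :> F)%R by rewrite mx2_det mulr1 mulr0 subr0.
  have [u uS Eu] := SL2_lift dU.
  have [u2 uI] := unipotent_no_invol card_F uS Eu.
  exists (coset _ u); split=> //; first exact: pr_in.
  apply/setP=> i; rewrite in_set0; apply/negP=> /setIP[/IP[iG i1 i2] /cent1P cui].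
  exact: (uI i iG i1 i2 (commute_sym cui)).
have torus i : i \in I -> exists x, [/\ x \in G, x * x != 1 & l x = [set i]]%g.
  case/IP=> iG i1 i2.
  have [x xG [cxi x2]] := invol_centralizer card_F k_gt1 iG i1 i2.
  exists x; split=> //; apply/setP=> j; rewrite in_set1.
  apply/setIP/eqP=> [[/IP[jG j1 j2] /cent1P cxj]|->].
    exact: (invol_unique card_F xG jG iG x2 j1 j2 i1 i2 (commute_sym cxj) cxi).
  by split; [rewrite inE iG i1 i2 eqxx | apply/cent1P/commute_sym].
have [i0 i0I] : exists i, i \in I.
  have [i [iG i1 i2]] := invol_exists card_F.
  by exists i; rewrite inE iG i1 i2 eqxx.
(* Otherwise x and u generate a soluble group, and the label of x would be part
   of the empty label of u. *)
have xV x i : x \in G -> (x * x != 1)%g -> l x = [set i] -> x \in solubility_vertices G.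
  move=> xG x2 lx; rewrite inE xG andbT; apply/negP=> xR.
  have := sol_sub x u xG uG x2 (radical_sol xR uG).
  by rewrite lx uI subset0 -cards_eq0 cards1.
have uV : u \in solubility_vertices G.
  rewrite inE uG andbT; apply/negP=> uR.
  have [x [xG x2 lx]] := torus i0 i0I.
  have := radical_sol uR xG; rewrite setUC => /(sol_sub x u xG uG x2).
  by rewrite lx uI subset0 -cards_eq0 cards1.
have ntI x : (x * x != 1)%g -> x \notin I.
  by move=> x2; rewrite inE (negPf x2) !andbF.
pose A := set0 |: [set [set i] | i in I].
have cA : #|A| = #|I|.+1.
  rewrite cardsU1 card_imset; last exact: set1_inj.
  case: imsetP => // -[i _ /esym/eqP]; by rewrite -cards_eq0 cards1.
have I_gt0 : 0 < #|I| by apply/card_gt0P; exists i0.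
suff : #|A| <= #|I| by rewrite cA ltnn.
apply: (cycle_label_bound (l := l) cyc); last by rewrite cA.
- move=> x y xI yI /and4P[xV' yV' _ sol].
  have [[xG x2] [yG y2]] := (notI x xV' xI, notI y yV' yI).
  by apply/eqP; rewrite eqEsubset !sol_sub // setUC.
- move=> a /setU1P[->|/imsetP[i iI ->]].
    by exists u; rewrite cV; split=> //; apply: ntI.
  have [x [xG x2 lx]] := torus i iI.
  exists x; rewrite cV; split=> //; [exact: (xV x i) | exact: ntI].
Qed.
End Graph.

Theorem theorem4p6 (F : finFieldType) (p : nat)
  (hp : prime p)
  (hF : (odd p /\ #|F| = 3 ^ p) \/
        [/\ p = 19 %[mod 24], (p = 2 %[mod 5] \/ p = 3 %[mod 5]) & #|F| = p]) :
  ~ has_hamiltonian_cycle (solubility_vertices (PSL2 F)) (solubility_adj (PSL2 F)).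
Proof.
suff [k [cF ok k3 k1]] : exists k, [/\ #|F|.+1 = 4 * k, odd k, ~~ (3 %| k) & 1 < k].
  exact: not_hamiltonian_PSL2 cF ok k3 k1.
case: hF => [[op ->]|[p19 _ ->]]; last first.
  by exists (p.+1 %/ 4); split; lia.
have [j ->] : exists j, p = j.*2.+3.
  by exists (p.-1./2.-1); have := prime_gt1 hp; lia.
exists ((3 ^ j.*2.+3).+1 %/ 4).
(* 3 ^ p = 3 mod 24 for odd p; the successor keeps track of p >= 3. *)
have [h ->] : exists h, 3 ^ j.*2.+3 = 3 * (8 * h.+1 + 1).
  elim: j => [|j [h Eh]]; first by exists 0.
  by exists (9 * h + 9); rewrite doubleS 2!expnS Eh; lia.
split; lia.
Qed.
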